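(* Let $E$ be a non-zero, separable Banach space with an unconditional Schauder decomposition $(E_\gamma)_{\gamma\in\Gamma}$. Then $\mathscr{B}(E)$ contains precisely $2^{\mathfrak{c}}$ maximal left ideals which are not finitely generated.
   Context: All Banach spaces are complex; $\mathscr{B}(E)$ is the Banach algebra of bounded linear operators on $E$, and $\mathfrak{c}=2^{\aleph_0}$. An unconditional Schauder decomposition of $E$ is an infinite family $(E_\gamma)_{\gamma\in\Gamma}$ of non-zero, closed subspaces of $E$ such that, for each $x\in E$, there is a unique family $(x_\gamma)_{\gamma\in\Gamma}$ with $x_\gamma\in E_\gamma$ for each $\gamma\in\Gamma$ such that the series $\sum_{\gamma\in\Gamma}x_\gamma$ converges unconditionally to $x$. A left ideal is finitely generated if it equals $\{\sum_{T\in\Delta}S_TT: S_T\in\mathscr{B}(E)\}$ for some non-empty finite $\Delta\subseteq\mathscr{B}(E)$. *)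

(* Defs.v *)
From HB Require Import structures.
From mathcomp Require Import all_boot all_order all_algebra finmap.
From mathcomp Require Import complex.
From mathcomp Require Import all_classical all_reals all_analysis.

Set Implicit Arguments.
Unset Strict Implicit.
Unset Printing Implicit Defensive.

Import Order.TTheory GRing.Theory Num.Theory.
Import numFieldNormedType.Exports.

Local Open Scope classical_set_scope.
Local Open Scope ring_scope.

Section BoundedOperators.
Variables (K : numFieldType) (E : normedModType K).

Definition bounded_operator (T : E -> E) : Prop :=
  linear T /\ exists M : K, forall x, `|T x| <= M * `|x|.

Definition bounded_operator_pred : {pred E -> E} :=
  [pred T | `[< bounded_operator T >]].

Record bop := Bop { bop_fun :> E -> E; _ : bop_fun \in bounded_operator_pred }.

HB.instance Definition _ := [isSub for bop_fun].
HB.instance Definition _ := [Choice of bop by <:].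

Lemma bopP (T : bop) : bounded_operator T.
Proof. by case: T => T /= /asboolP. Qed.

Lemma bop_ext (S T : bop) : S =1 T -> S = T.
Proof. by move=> ST; apply: val_inj; apply/funext. Qed.

Lemma bounded_operator_submod_closed :
  submod_closed bounded_operator_pred.
Proof.
split.
  apply/asboolP; split; first by move=> a x y; rewrite /= scaler0 addr0.
  by exists 0 => x; rewrite mul0r normr0.
move=> a S T /asboolP[linS [M bS]] /asboolP[linT [N bT]]; apply/asboolP; split.
  move=> b x y; rewrite /= !fctE /= linS linT !scalerDr !scalerA (mulrC a b).
  by rewrite addrACA.
exists (`|a| * M + N) => x; rewrite fctE (le_trans (ler_normD _ _))// mulrDl.
by rewrite lerD// normrZ -mulrA ler_wpM2l.
Qed.

HB.instance Definition _ := GRing.isSubmodClosed.Build _ _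
  bounded_operator_pred bounded_operator_submod_closed.
HB.instance Definition _ := [SubChoice_isSubLmodule of bop by <:].

Lemma bounded_operator_id : bounded_operator idfun.
Proof. by split=> //; exists 1 => x; rewrite mul1r. Qed.

Lemma bounded_operator_comp (S T : bop) : bounded_operator (S \o T).
Proof.
have [linS [M bS]] := bopP S; have [linT [N bT]] := bopP T; split.
  by move=> a x y; rewrite /= linT linS.
exists (`|M| * N) => x /=; apply: le_trans (bS _) _.
have Mreal : M * `|T x| \is Num.real by apply: ger0_real; apply: le_trans (bS _).
rewrite (le_trans (real_ler_norm Mreal))// normrM normr_id -mulrA.
by rewrite ler_wpM2l.
Qed.

Definition bop_one : bop := Bop (asboolT bounded_operator_id).
Definition bop_mul (S T : bop) : bop := Bop (asboolT (bounded_operator_comp S T)).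

Lemma bop_addE (S T : bop) x : (S + T) x = S x + T x. Proof. by []. Qed.

Fact bop_mulA : associative bop_mul. Proof. by move=> S T U; apply: bop_ext. Qed.
Fact bop_mul1l : left_id bop_one bop_mul. Proof. by move=> T; apply: bop_ext. Qed.
Fact bop_mul1r : right_id bop_one bop_mul. Proof. by move=> T; apply: bop_ext. Qed.
Fact bop_mulDl : left_distributive bop_mul +%R.
Proof. by move=> S T U; apply: bop_ext. Qed.
Fact bop_mulDr : right_distributive bop_mul +%R.
Proof.
move=> S T U; apply: bop_ext => x; have [linS _] := bopP S.
by rewrite bop_addE /=; have := linS 1 (T x) (U x); rewrite !scale1r.
Qed.

HB.instance Definition _ := GRing.Zmodule_isPzRing.Build bop
  bop_mulA bop_mul1l bop_mul1r bop_mulDl bop_mulDr.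

Lemma bop_mulE (S T : bop) x : (S * T) x = S (T x). Proof. by []. Qed.

End BoundedOperators.

Section LeftIdeals.
Variable A : pzRingType.
Implicit Types I J : set A.

(* As A has a unit, closure under opposites, and under scalars when A is an
   algebra, is automatic. *)
Definition left_ideal I : Prop :=
  [/\ I 0, forall x y, I x -> I y -> I (x + y) & forall a x, I x -> I (a * x)].

Definition maximal_left_ideal I : Prop :=
  [/\ left_ideal I, I <> setT &
      forall J, left_ideal J -> I `<=` J -> J = I \/ J = setT].

Definition finitely_generated_left_ideal I : Prop :=
  exists2 D : {fset A}, D != fset0 &
    I = [set x | exists s : A -> A, x = \sum_(t <- D) s t * t].

End LeftIdeals.

Definition separable_space (T : topologicalType) : Prop :=
  exists2 D : set T, countable D & dense D.

Section SchauderDecomposition.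
Variables (K : numFieldType) (E : normedModType K) (G : choiceType).

(* Convergence of the net of partial sums over the finite subsets of G,
   directed by inclusion. *)
Definition unconditional_sum (y : G -> E) (x : E) : Prop :=
  forall U : set E, nbhs x U ->
    exists A0 : {fset G}, forall A : {fset G},
      (A0 `<=` A)%fset -> U (\sum_(g <- A) y g).

Definition closed_subspace (F : set E) : Prop :=
  submod_closed [pred x | x \in F] /\ closed F.

Definition unconditional_schauder_decomposition (F : G -> set E) : Prop :=
  [/\ infinite_set [set: G],
      forall g, closed_subspace (F g) /\ F g <> [set 0] &
      forall x : E, exists! y : G -> E,
        (forall g, F g (y g)) /\ unconditional_sum y x].

End SchauderDecomposition.

(* Main.v *)
From HB Require Import structures.
Require Import Defs.
From mathcomp Require Import all_boot all_order all_algebra finmap.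
From mathcomp Require Import complex ring lra.
From mathcomp Require Import all_classical all_reals all_analysis.
From mathcomp.analysis Require Import showcase.summability.

(** The upper bound is a count of subsets: a bounded operator is determined by
    its values on a countable dense set, each of which is determined by its
    approximations from that set, so B(E) injects into the subsets of nat
    ([bop_codes]) and its left ideals into the sets of subsets of nat.

    For the lower bound, every set S of indices has a bounded projection P_S
    that fixes F g for g in S and kills it for the other g ([projection_ex]).
    Index a family Y a of subsets of G by the subsets a of nat so that every
    finite Boolean combination of the Y a and their complements is non-empty
    (Fichtenholz-Kantorovich-Hausdorff, [independent_setP]).  Given a set s of
    subsets of nat, the operators that vanish on all F g with g in some finite
    intersection of sets Y a (a in s) and complements of Y a (a not in s) form
    a proper left ideal, because such an intersection is non-empty and F g is
    non-zero.  Let Phi s be a maximal left ideal above it.  If a is in s but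
    not in t, then 1 - P_(Y a) is in Phi s and P_(Y a) is in Phi t, so the two
    ideals differ; this gives 2^c maximal left ideals
    ([maximal_left_ideals_inj]).

    The ones that are finitely generated are too few to matter: a finite set of
    operators is coded by a subset of nat, so there are at most c of them.  Cut
    the index set of Phi into 2^c rows of size 2^c; at most c rows meet the
    finitely generated ideals, and any other row does the job ([avoid_range]).
    The conclusion follows by Cantor-Bernstein.

    The boundedness of P_S is the analytic core.  The supremum of the norms of
    the finite partial sums of the decomposition of x is a seminorm, finite at
    every x and countably subadditive ([unc_norm_series]), the latter by
    completeness of E, closedness of the F g and uniqueness of the
    decomposition.  A countably subadditive seminorm on a Banach space is
    bounded (Zabreiko's lemma, [zabreiko]), which rests on Baire's theorem. *)

Set Implicit Arguments.
Unset Strict Implicit.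
Unset Printing Implicit Defensive.

Import Order.TTheory GRing.Theory Num.Theory.
Import numFieldNormedType.Exports.

Local Open Scope classical_set_scope.
Local Open Scope complex_scope.
Local Open Scope card_scope.
Local Open Scope ring_scope.

(** * The norm as a real number *)

Section RealNorm.
Variables (R : realType) (E : normedModType R[i]).
Implicit Types (x y : E) (t : R).

(** The norm of a complex normed space takes its values in R[i], which is only
    partially ordered and has no suprema; its real part carries the same
    information. *)
Definition rnorm x : R := complex.Re `|x|.

Lemma rnormE x : (rnorm x)%:C = `|x|.
Proof. by rewrite /rnorm RRe_real// normr_real. Qed.

Lemma rnorm_ge0 x : 0 <= rnorm x.
Proof. by rewrite -ler0c rnormE. Qed.

Lemma rnorm0 : rnorm 0 = 0 :> R.
Proof. by apply: complexI; rewrite rnormE normr0. Qed.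

Lemma rnorm_eq0 x : rnorm x = 0 -> x = 0.
Proof. by move=> x0; apply: normr0_eq0; rewrite -rnormE x0. Qed.

Lemma rnormN x : rnorm (- x) = rnorm x.
Proof. by rewrite /rnorm normrN. Qed.

Lemma rdistC x y : rnorm (x - y) = rnorm (y - x).
Proof. by rewrite /rnorm distrC. Qed.

Lemma rnormZ t x : rnorm (t%:C *: x) = `|t| * rnorm x.
Proof.
apply: complexI; rewrite rmorphM /= rnormE normrZ rnormE; congr (_ * _).
by rewrite normc_def /= expr0n addr0 sqrtr_sqr.
Qed.

Lemma ler_rnormD x y : rnorm (x + y) <= rnorm x + rnorm y.
Proof. by rewrite -lecR rmorphD /= !rnormE ler_normD. Qed.

Lemma ler_rnormB x y : rnorm (x - y) <= rnorm x + rnorm y.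
Proof. by rewrite -(rnormN y) ler_rnormD. Qed.

Lemma ler_rdistD z x y : rnorm (x - y) <= rnorm (x - z) + rnorm (z - y).
Proof. by rewrite (le_trans _ (ler_rnormD _ _))// subrKA. Qed.

Lemma eq_rdist_le x y : (forall e : R, 0 < e -> rnorm (x - y) <= e) -> x = y.
Proof.
move=> xy; apply: subr0_eq; apply: rnorm_eq0; apply/eqP.
rewrite eq_le rnorm_ge0 andbT; apply/ler_addgt0Pr => e e0.
by rewrite add0r; exact: xy.
Qed.

Lemma ler_rnorm_sum (I : Type) (r : seq I) (P : pred I) (f : I -> E) :
  rnorm (\sum_(i <- r | P i) f i) <= \sum_(i <- r | P i) rnorm (f i).
Proof.
elim/big_rec2 : _ => [|i c x _ xc]; first by rewrite rnorm0.
by rewrite (le_trans (ler_rnormD _ _))// lerD2l.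
Qed.

Lemma complex_gt0P (e : R[i]) : 0 < e -> exists2 t : R, 0 < t & e = t%:C.
Proof.
move=> e0; have /complex_realP[t et] : e \is Num.real by apply: gtr0_real.
by exists t; rewrite // -ltcR -et.
Qed.

Section Filter.
Variables (T : Type) (Phi : set_system T).
Context {PhiF : ProperFilter Phi}.
Implicit Types (f g : T -> E).

Lemma cvg_rnormP f x : f @ Phi --> x <->
  forall e : R, 0 < e -> \forall t \near Phi, rnorm (x - f t) < e.
Proof.
rewrite cvgrPdist_lt; split=> h e.
  move=> e0; have := h e%:C; rewrite ltcR => /(_ e0).
  by apply: filterS => t; rewrite -rnormE ltcR.
move=> /complex_gt0P[t t0 ->]; apply: filterS (h _ t0) => s.
by rewrite -rnormE ltcR.
Qed.

Lemma cvg_rnorm_le f x y c : f @ Phi --> x ->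
  (\forall t \near Phi, rnorm (y - f t) <= c) -> rnorm (y - x) <= c.
Proof.
move=> /cvg_rnormP fx fc; apply/ler_addgt0Pr => e e0.
have [t [ft xt]] := filter_ex (filterI fc (fx _ e0)).
by rewrite (le_trans (ler_rdistD (f t) _ _))// lerD// rdistC ltW.
Qed.

Lemma cvg_rnorm_le0 f x c : f @ Phi --> x ->
  (\forall t \near Phi, rnorm (f t) <= c) -> rnorm x <= c.
Proof.
move=> fx fc; rewrite -rnormN -sub0r; apply: cvg_rnorm_le fx _.
by apply: filterS fc => t; rewrite sub0r rnormN.
Qed.

Lemma cvg_runique f x y : f @ Phi --> x -> f @ Phi --> y -> x = y.
Proof. exact: (cvg_unique (@norm_hausdorff _ E)). Qed.

End Filter.

End RealNorm.

(** * Zabreiko's lemma *)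

Section Complete.
Variables (R : realType) (E : completeNormedModType R[i]).

Lemma rnorm_cauchy_cvg (T : Type) (Phi : set_system T) {PhiF : ProperFilter Phi}
    (f : T -> E) :
  (forall e : R, 0 < e ->
    exists y, \forall t \near Phi, rnorm (y - f t) < e) ->
  exists x : E, f @ Phi --> x.
Proof.
move=> h; suff fc : cauchy (f @ Phi).
  by exists (lim (f @ Phi) : E); exact: (@cauchy_cvg E _ _ fc).
apply: cauchy_exP => _ /complex_gt0P[e e0 ->]; have [y ye] := h e e0.
by exists y; apply: filterS ye => t; rewrite -ball_normE /= -rnormE ltcR.
Qed.

(** A rate b that tends to 0 gives not only the limit of u, but the same rate
    of convergence to it. *)
Lemma cvg_rate (u : nat -> E) (b : nat -> R) :
  (forall n m, (n <= m)%N -> rnorm (u n - u m) <= b n) ->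
  (forall e, 0 < e -> exists n, b n < e) ->
  exists2 x, u @ \oo --> x & forall n, rnorm (u n - x) <= b n.
Proof.
move=> ub b0; have [|x ux] := @rnorm_cauchy_cvg _ \oo _ u.
  move=> e /b0[n ne]; exists (u n); near=> m.
  by rewrite (le_lt_trans (ub _ _ _) ne)//; near: m; apply: nbhs_infty_ge.
exists x => // n; apply: cvg_rnorm_le ux _; near=> m; apply: ub.
by near: m; apply: nbhs_infty_ge.
Unshelve. all: by end_near. Qed.

Lemma half_expn_lt (e c : R) : 0 < e -> exists n, 2^-1 ^+ n * c < e.
Proof.
move=> e0; have c1 : 0 < `|c| + 1 by rewrite ltr_wpDl.
have [n _ /(_ n (leqnn n))] :=
  near_infty_natSinv_expn_lt (PosNum (divr_gt0 e0 c1)).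
rewrite /= ltr_pdivlMr// div1r -exprVn => ne; exists n.
apply: le_lt_trans ne; rewrite ler_wpM2l ?exprn_ge0 ?invr_ge0//.
by rewrite (le_trans (ler_norm _))// lerDl.
Qed.

(** Baire's theorem in the form used below: if countably many sets cover E, one
    of them is dense in some ball.  Otherwise one builds nested balls, the n-th
    at a positive distance from V n, and their common point lies in no V n. *)
Lemma baire_cover (V : nat -> set E) : (forall x, exists n, V n x) ->
  exists n (a : E), exists2 r : R, 0 < r & forall y : E, rnorm (a - y) < r ->
    forall e : R, 0 < e -> exists2 v, V n v & rnorm (y - v) < e.
Proof.
move=> Vcov; apply: contrapT => nex.
have step (np : nat * (E * R)) : exists q : E * R, 0 < np.2.2 ->
    [/\ 0 < q.2, q.2 <= np.2.2 / 2, rnorm (np.2.1 - q.1) + q.2 <= np.2.2 &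
        forall v, V np.1 v -> q.2 < rnorm (q.1 - v)].
  case: np => n [a r] /=; have [r0|] := ltP 0 r; last by exists (0, 0).
  have [y [yr [e e0 ye]]] : exists y : E, rnorm (a - y) < r /\
      exists2 e : R, 0 < e & forall v, V n v -> e <= rnorm (y - v).
    apply: contrapT => ny; apply: nex; exists n, a, r => // y yr e e0.
    apply: contrapT => nv; apply: ny; exists y; split=> //; exists e => // v Vv.
    by rewrite leNgt; apply/negP => lt; apply: nv; exists v.
  (* Halving e keeps the new closed ball strictly away from V n, the second
     bound makes the radii tend to 0, and the third nests the balls. *)
  exists (y, Num.min (e / 2) (Num.min (r / 2) (r - rnorm (a - y)))) => _ /=.
  split.
  - by rewrite !lt_min subr_gt0 yr !divr_gt0.
  - by rewrite !ge_min lexx orbT.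
  - by rewrite addrC -lerBrDr !ge_min lexx !orbT.
  - move=> v /ye ev; rewrite gt_min; apply/orP; left; lra.
have [f fP] := choice step.
pose fix ar n := if n is m.+1 then f (m, ar m) else (0 : E, 1 : R).
have r0 n : 0 < (ar n).2 by elim: n => //= n /(fP (n, ar n))[].
have r2 n : (ar n).2 <= 2^-1 ^+ n.
  elim: n => //= n IHn; have [_ + _ _] := fP (n, ar n) (r0 n).
  move=> /le_trans; apply; rewrite exprS /=; lra.
have nested n m : (n <= m)%N ->
    rnorm ((ar n).1 - (ar m).1) + (ar m).2 <= (ar n).2.
  move=> /subnK <-; elim: (m - n)%N => [|k IHk].
    by rewrite subrr rnorm0 add0r.
  have [_ _ + _] := fP (k + n, ar (k + n))%N (r0 _).
  rewrite addSn; set q := f _ => /= h.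
  by have := ler_rdistD (ar (k + n)%N).1 (ar n).1 q.1; lra.
have [||x _ xr] := @cvg_rate (fun n => (ar n).1) (fun n => (ar n).2).
- by move=> n m /nested; have := r0 m; lra.
- move=> e /(half_expn_lt 1)[n ne]; exists n.
  by rewrite mulr1 in ne; apply: le_lt_trans ne.
have [n Vx] := Vcov x; have [_ _ _ /(_ _ Vx)] := fP (n, ar n) (r0 n).
by rewrite ltNge (xr n.+1).
Qed.

(** Baire's theorem makes some sublevel set of p dense in a ball, hence, by
    symmetry, convexity and homogeneity, {p <= c |x|} approximates every x as
    closely as desired.  Approximating x, then the remainder, and so on, writes
    x as a series of vectors u k with p (u k) <= c |x| / 2^k, and countable
    subadditivity gives p x <= 2 c |x|. *)
Lemma zabreiko (p : E -> R) :
  (forall x y, p (x + y) <= p x + p y) ->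
  (forall (t : R) x, p (t%:C *: x) <= `|t| * p x) ->
  (forall u x c, series u @ \oo --> x ->
     (forall n, \sum_(0 <= k < n) p (u k) <= c) -> p x <= c) ->
  exists C, forall x, p x <= C * rnorm x.
Proof.
move=> pD pZ psum.
have p0 : p 0 <= 0 by have := pZ 0 0; rewrite scaler0 normr0 mul0r.
have pN x : p (- x) <= p x.
  by have := pZ (-1) x; rewrite rmorphN1 scaleN1r normrN1 mul1r.
have [|n [a [r r0 ar]]] := @baire_cover (fun n => [set x | p x <= n%:R]).
  by move=> x; exists (Num.truncn (p x)).+1; rewrite /= ltW// truncnS_gt.
(* Centring the ball at 0: h is half the difference of a + h and a - h. *)
have near0 (h : E) (e : R) : rnorm h < r -> 0 < e ->
    exists2 v, p v <= n%:R & rnorm (h - v) < e.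
  move=> hr e0.
  have h1 : rnorm (a - (a + h)) < r by rewrite opprD addrA subrr sub0r rnormN.
  have h2 : rnorm (a - (a - h)) < r by rewrite opprB addrC subrK.
  have [v1 /= p1 d1] := ar _ h1 e e0; have [v2 /= p2 d2] := ar _ h2 e e0.
  exists (2^-1%:C *: (v1 - v2)).
    apply: le_trans (pZ _ _) _; rewrite ger0_norm ?invr_ge0//.
    by have := pD v1 (- v2); have := pN v2; lra.
  have -> : h - 2^-1%:C *: (v1 - v2) = 2^-1%:C *: ((a + h - v1) - (a - h - v2)).
    have -> : a + h - v1 - (a - h - v2) = (2 : R)%:C *: h - (v1 - v2).
      rewrite opprD addrACA -opprD; congr (_ - _).
      by rewrite opprB addrC subrKA rmorph_nat scaler_nat mulr2n.
    by rewrite [RHS]scalerBr scalerA -rmorphM /= mulVf ?pnatr_eq0// scale1r.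
  rewrite rnormZ ger0_norm ?invr_ge0//.
  by have := ler_rnormB (a + h - v1) (a - h - v2); lra.
pose c := 2 * n%:R / r.
have c0 : 0 <= c by rewrite divr_ge0 ?mulr_ge0 ?ler0n// ltW.
have approx (x : E) : exists v : E,
    p v <= c * rnorm x /\ rnorm (x - v) <= 2^-1 * rnorm x.
  have [x0|x0] := eqVneq (rnorm x) 0.
    by exists 0; rewrite subr0 x0 !mulr0.
  have {}x0 : 0 < rnorm x by rewrite lt_def x0 rnorm_ge0.
  (* Rescaling x to norm r / 2 puts it inside the ball. *)
  pose t := r / (2 * rnorm x).
  have t0 : 0 < t by rewrite divr_gt0 ?mulr_gt0.
  have [||v pv xv] := near0 (t%:C *: x) (t * (2^-1 * rnorm x)).
  - rewrite rnormZ gtr0_norm// /t.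
    have -> : r / (2 * rnorm x) * rnorm x = r / 2 by field; rewrite gt_eqF.
    lra.
  - by apply: mulr_gt0 => //; apply: mulr_gt0; rewrite ?invr_gt0.
  exists (t^-1%:C *: v); split.
    apply: le_trans (pZ _ _) _; rewrite gtr0_norm ?invr_gt0//.
    have -> : c * rnorm x = t^-1 * n%:R.
      by rewrite /t /c; field; rewrite !gt_eqF.
    by rewrite ler_wpM2l// invr_ge0 ltW.
  rewrite -(ler_pM2l t0) ltW//; apply: le_lt_trans xv.
  rewrite -{1}(gtr0_norm t0) -rnormZ scalerBr scalerA -rmorphM /=.
  by rewrite divff ?gt_eqF// scale1r.
have [f fP] := choice approx.
exists (2 * c) => x.
pose res k : E := iter k (fun y : E => y - f y) x.
have resE k : rnorm (res k) <= 2^-1 ^+ k * rnorm x.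
  elim: k => [|k IHk]; first by rewrite mul1r.
  rewrite exprS -mulrA /=; apply: le_trans (fP (res k)).2 _.
  by rewrite ler_wpM2l ?invr_ge0.
have serE k : series (fun k => f (res k)) k = x - res k.
  elim: k => [|k IHk]; first by rewrite /series /= big_geq// subrr.
  by rewrite seriesSr IHk /= opprD opprK addrA.
apply: (psum (fun k => f (res k))).
  apply/cvg_rnormP => e /(half_expn_lt (rnorm x))[k ke]; near=> m.
  rewrite serE opprB addrC subrK.
  apply: le_lt_trans (resE m) (le_lt_trans _ ke).
  rewrite ler_wpM2r ?rnorm_ge0// ler_wiXn2l ?invr_ge0 ?invf_le1 ?ler1n//.
  by near: m; apply: nbhs_infty_ge.
move=> m; apply: (@le_trans _ _ (2 * c * (1 - 2^-1 ^+ m) * rnorm x)).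
  elim: m => [|m IHm]; first by rewrite big_geq// expr0 subrr mulr0 mul0r.
  rewrite big_nat_recr//= exprS.
  have := ler_wpM2l c0 (resE m); have := (fP (res m)).1; lra.
apply: ler_wpM2r; rewrite ?rnorm_ge0//.
have : 0 <= 2^-1 ^+ m :> R by rewrite exprn_ge0 ?invr_ge0.
move=> h; have c2 : 0 <= 2 * c by lra.
by rewrite ler_piMr//; lra.
Unshelve. all: by end_near. Qed.

End Complete.

(** * Unconditional sums *)

#[local] Existing Instance totally_filter.

Lemma big_fsetU_cond (V : nmodType) (G : choiceType) (A B : {fset G})
    (f : G -> V) :
  \sum_(g <- (A `|` B)%fset) f g =
  \sum_(g <- A) f g + \sum_(g <- B | g \notin A) f g.
Proof.
rewrite (big_fsetID _ (fun g => g \in A)) /=; congr (_ + _).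
  congr (\sum_(i <- enum_fset _) _); apply/fsetP => g; rewrite !inE /=.
  by case: (g \in A); rewrite ?orbT ?andbF.
rewrite [RHS]big_fset_condE; congr (\sum_(i <- enum_fset _) _).
by apply/fsetP => g; rewrite !inE /=; case: (g \in A); rewrite ?andbF.
Qed.

Lemma near_totally (G : choiceType) (A : {fset G}) (P : {fset G} -> Prop) :
  (forall B, (A `<=` B)%fset -> P B) -> \forall B \near totally, P B.
Proof. by move=> AP; exists A. Qed.

Section UnconditionalSums.
Variables (R : realType) (E : normedModType R[i]) (G : choiceType).
Implicit Types (x : E) (y : G -> E) (A B : {fset G}).

Lemma unconditional_sumP y x : unconditional_sum y x <->
  (fun A : {fset G} => \sum_(g <- A) y g) @ totally --> x.
Proof.
split=> h U.
  by move=> /h[A AU]; exists A => // B /AU.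
by move=> /h[A _ AU]; exists A => B /AU.
Qed.

Lemma unconditional_sum_lin (a : R[i]) y1 y2 x1 x2 :
  unconditional_sum y1 x1 -> unconditional_sum y2 x2 ->
  unconditional_sum (fun g => a *: y1 g + y2 g) (a *: x1 + x2).
Proof.
move=> /unconditional_sumP h1 /unconditional_sumP h2; apply/unconditional_sumP.
have -> : (fun A : {fset G} => \sum_(g <- A) (a *: y1 g + y2 g)) =
    (fun A : {fset G} => a *: (\sum_(g <- A) y1 g)) +
    (fun A : {fset G} => \sum_(g <- A) y2 g).
  by apply/funext => A; rewrite big_split /= fctE -scaler_sumr.
by apply: cvgD h2; apply: cvgZ h1; exact: cvg_cst.
Qed.

Lemma unconditional_sum_unique y x1 x2 :
  unconditional_sum y x1 -> unconditional_sum y x2 -> x1 = x2.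
Proof.
move=> /unconditional_sumP h1 /unconditional_sumP h2.
exact: cvg_runique h1 h2.
Qed.

Lemma unconditional_sum_delta (g0 : G) x :
  unconditional_sum (fun g => if g == g0 then x else 0) x.
Proof.
apply/unconditional_sumP/cvg_rnormP => e e0.
apply: (@near_totally G [fset g0]%fset).
move=> A; rewrite fsub1set => g0A; rewrite (big_fsetD1 _ g0A)/= eqxx big1_seq.
  by rewrite addr0 subrr rnorm0.
by move=> g /=; rewrite !inE => /andP[/negPf ->].
Qed.

(** The Cauchy criterion: finite sums that avoid A are small. *)
Lemma unconditional_sum_tail y x (e : R) : unconditional_sum y x -> 0 < e ->
  exists A, forall B, rnorm (\sum_(g <- B | g \notin A) y g) < e.
Proof.
move=> /unconditional_sumP/cvg_rnormP h e0.
have [A _ AU] := h (e / 2) (divr_gt0 e0 (ltr0Sn _ 1)).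
exists A => B.
have := AU _ (fsubsetUl A B); have := AU _ (fsubset_refl A).
rewrite /= big_fsetU_cond; set sA := \sum_(g <- A) _.
set sB := \sum_(g <- B | _) _.
have := ler_rdistD x (sA + sB) sA.
by rewrite addrAC subrr add0r [rnorm (_ + _ - x)]rdistC; lra.
Qed.

(** A finite sum splits into its part inside the set A given by the Cauchy
    criterion, which has finitely many terms to choose from, and its small part
    outside A. *)
Lemma unconditional_sum_bounded y x : unconditional_sum y x ->
  exists c : R, forall B, rnorm (\sum_(g <- B) y g) <= c.
Proof.
move=> /unconditional_sum_tail/(_ ltr01)[A Atail].
exists (\sum_(g <- A) rnorm (y g) + 1) => B.
rewrite (bigID (fun g => g \in A))/= (le_trans (ler_rnormD _ _))//.
rewrite lerD//; last exact: ltW.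
apply: le_trans (ler_rnorm_sum _ _ _) _.
rewrite [leRHS](bigID (fun g => g \in B))/= big_fset_condE.
have -> : [fset g in B | g \in A]%fset = [fset g in A | g \in B]%fset.
  by apply/fsetP => g; rewrite !inE /= andbC.
by rewrite -big_fset_condE lerDl sumr_ge0// => g _; exact: rnorm_ge0.
Qed.

End UnconditionalSums.
Arguments unconditional_sum_lin {R E G} a {y1 y2 x1 x2} _ _ : rename.
Arguments unconditional_sum_delta {R E G} g0 x : rename.

(** The Cauchy criterion is inherited by subfamilies, so completeness yields
    their sums. *)
Lemma unconditional_subsum (R : realType) (E : completeNormedModType R[i])
    (G : choiceType) (y : G -> E) (x : E) (S : set G) :
  unconditional_sum y x ->
  exists z : E, unconditional_sum (fun g => if g \in S then y g else 0) z.
Proof.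
move=> yx; pose yS g : E := if g \in S then y g else 0.
pose sums (A : {fset G}) : E := \sum_(g <- A) yS g.
have [e h|z h] := @rnorm_cauchy_cvg _ E _ totally _ sums.
  have [A Atail] := unconditional_sum_tail yx h.
  exists (sums A); apply: (@near_totally G A) => B AB.
  rewrite /sums -(fsetUidPr _ _ AB) big_fsetU_cond.
  rewrite opprD addrA subrr sub0r rnormN.
  rewrite /yS -big_mkcondr /=.
  have -> : \sum_(g <- B | (g \notin A) && (g \in S)) y g =
      \sum_(g <- [fset g in B | g \in S]%fset | g \notin A) y g.
    rewrite big_fset_condE [RHS]big_fset_condE.
    congr (\sum_(i <- enum_fset _) _).
    by apply/fsetP => g; rewrite !inE /= -andbA [(g \in S) && _]andbC.
  exact: Atail.
by exists z; apply/unconditional_sumP.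
Qed.

(** * Projections of an unconditional decomposition *)

Section Projections.
Variables (R : realType) (E : completeNormedModType R[i]) (G : choiceType).
Variables (F : G -> set E) (hF : unconditional_schauder_decomposition F).

Lemma piece0 g : F g 0.
Proof. by have [_ /(_ g)[[[]]]] := hF; rewrite inE. Qed.

Lemma piece_lin g (a : R[i]) (x y : E) : F g x -> F g y -> F g (a *: x + y).
Proof.
have [_ /(_ g)[[[_ h] _] _] _] := hF => Fx Fy.
by have := h a x y; rewrite !inE; exact.
Qed.

Lemma piece_closed g : closed (F g).
Proof. by have [_ /(_ g)[[]]] := hF. Qed.

Lemma piece_neq0 g : exists2 v, F g v & v != 0.
Proof.
have [_ /(_ g)[_ F0] _] := hF; apply: contrapT => h; apply: F0.
apply/seteqP; split=> [v Fv|_ ->]; last exact: piece0.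
by apply: contrapT => /eqP v0; apply: h; exists v.
Qed.

Let coord_ex (x : E) : exists y : G -> E,
  [/\ forall g, F g (y g), unconditional_sum y x &
      forall z, (forall g, F g (z g)) -> unconditional_sum z x -> y = z].
Proof.
have [_ _ /(_ x)[y [[Fy yx] u]]] := hF.
by exists y; split=> // z Fz zx; apply: u.
Qed.

Definition coord (x : E) : G -> E := sval (cid (coord_ex x)).

Lemma coordP x g : F g (coord x g).
Proof. by rewrite /coord; case: cid => y []. Qed.

Lemma coord_sum x : unconditional_sum (coord x) x.
Proof. by rewrite /coord; case: cid => y []. Qed.

Arguments coord_sum : clear implicits.

Lemma coord_unique x z : (forall g, F g (z g)) -> unconditional_sum z x ->
  coord x = z.
Proof. by move=> Fz zx; rewrite /coord; case: cid => y [_ _ ] /=; apply. Qed.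

Lemma coord_lin (a : R[i]) (x y : E) g :
  coord (a *: x + y) g = a *: coord x g + coord y g.
Proof.
rewrite (@coord_unique _ (fun g => a *: coord x g + coord y g))//.
  by move=> h; apply: piece_lin; exact: coordP.
by apply: unconditional_sum_lin; exact: coord_sum.
Qed.

Lemma coord_piece g0 v g : F g0 v -> coord v g = if g == g0 then v else 0.
Proof.
move=> Fv; rewrite (@coord_unique _ (fun g => if g == g0 then v else 0))//.
  by move=> h; case: eqP => [->//|_]; exact: piece0.
exact: unconditional_sum_delta.
Qed.

Definition partial_coord (B : {fset G}) (x : E) : E := \sum_(g <- B) coord x g.

Lemma partial_coord_lin B : linear (partial_coord B).
Proof.
move=> a x y; rewrite /partial_coord scaler_sumr -big_split /=.
by apply: eq_bigr => g _; rewrite coord_lin.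
Qed.

Lemma partial_coordB B x y :
  partial_coord B (x - y) = partial_coord B x - partial_coord B y.
Proof.
by rewrite addrC -scaleN1r partial_coord_lin scaleN1r addrC.
Qed.

Lemma partial_coord0 B : partial_coord B 0 = 0.
Proof. by rewrite -{1}(subrr 0) partial_coordB subrr. Qed.

(** The unconditional norm attached to the decomposition: the projections onto
    sets of indices are contractions for it, so they become bounded once it is
    known to be dominated by the norm of E. *)
Definition unc_norm (x : E) : R :=
  sup [set rnorm (partial_coord B x) | B in [set: {fset G}]].

Lemma unc_norm_le x c :
  (forall B, rnorm (partial_coord B x) <= c) -> unc_norm x <= c.
Proof.
move=> h; apply: ge_sup; last by move=> _ [B _ <-].
by exists (rnorm (partial_coord fset0 x)), fset0.
Qed.

Lemma le_unc_norm B x : rnorm (partial_coord B x) <= unc_norm x.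
Proof.
apply: ub_le_sup; last by exists B.
have [c xc] := unconditional_sum_bounded (coord_sum x).
by exists c => _ [A _ <-]; exact: xc.
Qed.

Lemma unc_normD x y : unc_norm (x + y) <= unc_norm x + unc_norm y.
Proof.
apply: unc_norm_le => B; rewrite -[x]scale1r partial_coord_lin !scale1r.
by rewrite (le_trans (ler_rnormD _ _))// lerD ?le_unc_norm.
Qed.

Lemma unc_norm0 : unc_norm 0 = 0.
Proof.
apply/eqP; rewrite eq_le; apply/andP; split.
  by apply: unc_norm_le => B; rewrite partial_coord0 rnorm0.
by apply: le_trans (le_unc_norm fset0 _); exact: rnorm_ge0.
Qed.

Lemma unc_normZ (t : R) x : unc_norm (t%:C *: x) <= `|t| * unc_norm x.
Proof.
apply: unc_norm_le => B; rewrite -[_ *: x]addr0 partial_coord_lin.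
rewrite partial_coord0 addr0 rnormZ.
by rewrite ler_wpM2l ?le_unc_norm.
Qed.

(** Countable subadditivity.  The finite partial sums of the decomposition of
    series u n are Cauchy in n, with a rate b n that depends on unc_norm (u k)
    only, thus is uniform in the finite set B of indices.  Their limits over
    singletons, w g, lie in the closed F g, and exchanging the two limits (by
    uniformity) shows that w sums unconditionally to x.  By uniqueness w is the
    decomposition of x. *)
Lemma unc_norm_series (u : nat -> E) (x : E) (c : R) : series u @ \oo --> x ->
  (forall n, \sum_(0 <= k < n) unc_norm (u k) <= c) -> unc_norm x <= c.
Proof.
move=> ux uc; pose s n := \sum_(0 <= k < n) unc_norm (u k).
have p0 x' : 0 <= unc_norm x' := le_trans (rnorm_ge0 _) (le_unc_norm fset0 x').
have s_sub n m : (n <= m)%N -> unc_norm (series u n - series u m) <= s m - s n.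
  move=> nm; rewrite -opprB sub_series_geq// /s.
  rewrite (big_cat_nat (leq0n n) nm)/= addrAC subrr add0r.
  have -> : - (\sum_(n <= k < m) u k) = (-1 : R)%:C *: \sum_(n <= k < m) u k.
    by rewrite rmorphN1 scaleN1r.
  apply: le_trans (unc_normZ _ _) _; rewrite normrN1 mul1r.
  elim/big_rec2 : _ => [|k a b _ ab]; first by rewrite unc_norm0.
  by apply: le_trans (unc_normD _ _) _; rewrite lerD2l.
have s_sup : has_sup (range s).
  by split; [exists (s 0%N), 0%N | exists c => _ [n _ <-]; exact: uc].
have s_le m : s m <= sup (range s) by apply: ub_le_sup; [case: s_sup|exists m].
pose b n := sup (range s) - s n.
have b0 e : 0 < e -> exists n, b n < e.
  move=> /(sup_adherent)/(_ s_sup)[_ [n _ <-] ne]; exists n; rewrite /b; lra.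
have rate B n m : (n <= m)%N ->
    rnorm (partial_coord B (series u n) - partial_coord B (series u m)) <= b n.
  move=> nm; rewrite -partial_coordB; apply: le_trans (le_unc_norm _ _) _.
  by apply: le_trans (s_sub _ _ nm) _; rewrite lerB.
have wex g : exists w : E,
    partial_coord [fset g]%fset (series u n) @[n --> \oo] --> w.
  by have [w h _] := cvg_rate (rate [fset g]%fset) b0; exists w.
have [w wP] := choice wex.
have wsum B n : rnorm (partial_coord B (series u n) - \sum_(g <- B) w g) <= b n.
  apply: (@cvg_rnorm_le _ _ _ \oo _ (fun m => partial_coord B (series u m))).
    rewrite /partial_coord; apply: cvg_big => [|g _].
      exact: add_continuous.
    have := wP g; rewrite /partial_coord.
    by under eq_fun do rewrite big_seq_fset1.
  near=> m; apply: rate; near: m; exact: nbhs_infty_ge.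
have Fw g : F g (w g).
  have := wP g; apply: closed_cvg; first exact: piece_closed.
  by apply: nearW => n; rewrite /partial_coord big_seq_fset1; exact: coordP.
have wx : unconditional_sum w x.
  apply/unconditional_sumP/cvg_rnormP => e e0.
  (* |x - x_m|, |x_m - P_A x_m| and |P_A x_m - sum_A w| with x_m = series u m;
     m is chosen before A, which only the second term constrains. *)
  have e3 : 0 < e / 3 by rewrite divr_gt0.
  have [n bn] := b0 _ e3.
  have [m [nm xm]] : exists m, (n <= m)%N /\ rnorm (x - series u m) < e / 3.
    have xe : \forall m \near \oo, rnorm (x - series u m) < e / 3.
      by move/cvg_rnormP : ux; apply.
    exact: filter_ex (filterI (nbhs_infty_ge n) xe).
  have bm : b m < e / 3.
    apply: le_lt_trans bn; rewrite /b lerB// /s.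
    by rewrite (big_cat_nat (leq0n n) nm)/= lerDl sumr_ge0.
  have /unconditional_sumP/cvg_rnormP/(_ _ e3) := coord_sum (series u m).
  apply: filterS => A; have := wsum A m.
  rewrite -/(partial_coord A (series u m)); set v := partial_coord _ _.
  have := ler_rdistD (series u m) x (\sum_(g <- A) w g).
  by have := ler_rdistD v (series u m) (\sum_(g <- A) w g); lra.
apply: unc_norm_le => B; rewrite /partial_coord (coord_unique Fw wx).
have := wsum B 0%N; rewrite /series /= big_geq// partial_coord0 sub0r rnormN.
move/le_trans; apply; rewrite /b /s big_geq// subr0.
by apply: ge_sup; [exists (s 0%N), 0%N | move=> _ [n _ <-]; exact: uc].
Unshelve. all: by end_near. Qed.

(** The projection onto S keeps the components with index in S: they are
    summable by [unconditional_subsum], uniqueness of sums makes the result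
    linear, and its norm is at most unc_norm, hence dominated by the norm. *)
Lemma projection_ex (S : set G) : exists P : bop E,
  forall g v, F g v -> P v = if g \in S then v else 0.
Proof.
have [f fP] := choice (fun x => unconditional_subsum S (coord_sum x)).
have [C pC] := zabreiko unc_normD unc_normZ unc_norm_series.
have fb : bounded_operator f.
  split.
    move=> a x y; apply: unconditional_sum_unique (fP _) _.
    have := unconditional_sum_lin a (fP x) (fP y).
    congr (unconditional_sum _ _); apply/funext => g; rewrite coord_lin.
    by case: ifP => //; rewrite scaler0 addr0.
  exists C%:C => x; rewrite -!rnormE -rmorphM lecR; apply: le_trans (pC x).
  have /unconditional_sumP := fP x; move=> /cvg_rnorm_le0; apply.
  apply: nearW => A; rewrite -big_mkcond big_fset_condE; exact: le_unc_norm.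
exists (Bop (asboolT fb)) => g v Fv /=.
apply: unconditional_sum_unique (fP v) _.
have := unconditional_sum_delta g (if g \in S then v else 0).
congr (unconditional_sum _ _); apply/funext => h; rewrite (coord_piece _ Fv).
by case: eqP => [->|]; rewrite ?if_same.
Qed.

End Projections.

(** * Maximal and finitely generated left ideals *)

Section MaximalLeftIdeals.
Variable A : pzRingType.
Implicit Types I J M : set A.

Lemma left_ideal1 J : left_ideal J -> J 1 -> J = setT.
Proof.
move=> [_ _ JM] J1; apply/seteqP; split=> // a _.
by rewrite -[a]mulr1; exact: JM.
Qed.

Lemma maximal_left_ideal1 M : maximal_left_ideal M -> ~ M 1.
Proof. by move=> [idM MT _] /(left_ideal1 idM). Qed.

(** Zorn's lemma is applied to the sets X for which I `|` X is a proper left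
    ideal, rather than to the proper left ideals above I, so that the union of
    the empty chain is admissible. *)
Lemma exists_maximal_left_ideal I : left_ideal I -> ~ I 1 ->
  exists2 M, maximal_left_ideal M & I `<=` M.
Proof.
move=> idI I1; pose P X := left_ideal (I `|` X) /\ ~ (I `|` X) 1.
have P0 : P set0 by rewrite /P setU0.
have [chF totF|X [[idX X1] maxX]] := @Zorn_bigcup A P.
  move=> FP; set U := \bigcup_(X in chF) X.
  have sub2 x y : (I `|` U) x -> (I `|` U) y ->
      exists X, [/\ P X, X `<=` U, (I `|` X) x & (I `|` X) y].
    have UP X : chF X -> P X /\ X `<=` U.
      by move=> FX; split; [exact: totF | exact: bigcup_sup].
    move=> [Ix|[X FX Xx]] [Iy|[Y FY Yy]].
    - by exists set0; split=> //; left.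
    - by exists Y; have [? ?] := UP _ FY; split=> //; [left|right].
    - by exists X; have [? ?] := UP _ FX; split=> //; [right|left].
    - have [XY|YX] := FP X Y FX FY.
        by exists Y; have [? ?] := UP _ FY; split=> //; right=> //; exact: XY.
      by exists X; have [? ?] := UP _ FX; split=> //; right=> //; exact: YX.
  split; last first.
    move=> U1; have [X [[_ X1] _ ? _]] := sub2 _ _ U1 U1.
    exact: X1.
  split.
  - by left; case: idI.
  - move=> x y Ux Uy; have [X [[[_ XD _] _] XU Xx Xy]] := sub2 _ _ Ux Uy.
    by have [|/XU] := XD _ _ Xx Xy; [left|right].
  - move=> a x Ux; have [X [[[_ _ XM] _] XU Xx _]] := sub2 _ _ Ux Ux.
    by have [|/XU] := XM a _ Xx; [left|right].
exists (I `|` X); last by move=> x; left.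
split=> //; first by move=> XT; apply: X1; rewrite XT.
move=> J idJ IXJ; have [J1|J1] := pselect (J 1).
  by right; exact: left_ideal1.
left; apply/seteqP; split=> //.
have PJ : P J.
  have -> // : P J = (left_ideal J /\ ~ J 1).
  by rewrite /P setUidr// => x Ix; apply: IXJ; left.
apply: contrapT => JX; apply: (maxX J) => //; split.
  by move=> x Xx; apply: IXJ; right.
by move=> JX'; apply: JX => x /JX'; right.
Qed.

(** Padding the generators with zeros gives one shape, a sequence, to all finite
    generating sets, which makes them easy to code. *)
Lemma finitely_generated_bigcap I :
  left_ideal I -> finitely_generated_left_ideal I ->
  exists t : nat -> A,
    I = \bigcap_(J in [set J | left_ideal J /\ forall i, J (t i)]) J.
Proof.
move=> idI [D _ ID]; exists (fun i => nth 0 D i); apply/seteqP; split.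
  move=> x; rewrite ID => -[s ->] J [[J0 JD JM] JDi].
  rewrite big_seq; elim/big_ind : _ => // t tD; apply: JM.
  by rewrite -(nth_index 0 tD); exact: JDi.
move=> x; apply; split=> // i; have [iD|Di] := ltnP i (size D); last first.
  by rewrite nth_default//; case: idI.
rewrite ID; exists (fun t => if t == nth 0 D i then 1 else 0).
rewrite (big_fsetD1 (nth 0 D i)) ?mem_nth//= eqxx mul1r big1_seq ?addr0// => t.
by rewrite !inE => /andP[_ /andP[/negPf -> _]]; rewrite mul0r.
Qed.

End MaximalLeftIdeals.

(** * An independent family of sets *)

Definition prefix_code (a : set nat) (n : nat) : seq bool :=
  mkseq (fun i => `[< a i >]) n.

(** Here a point (n, q) is a finite list q of words of length n, and it belongs
    to the set of index a when the first n bits of a form a word of q. *)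
Definition independent_set (a : set nat) : set (nat * seq (seq bool)) :=
  [set p : nat * seq (seq bool) | prefix_code a p.1 \in p.2].

Lemma prefix_code_separates (C : seq (set nat)) :
  exists n, forall a b, a \in C -> b \in C ->
    prefix_code a n = prefix_code b n -> a = b.
Proof.
have sep (ab : set nat * set nat) : exists i,
    ab.1 <> ab.2 -> `[< ab.1 i >] <> `[< ab.2 i >].
  have [->|neq] := pselect (ab.1 = ab.2); first by exists 0%N => /(_ erefl).
  apply: contrapT => nex; apply: neq; apply/funext => i; apply/propext.
  apply: asbool_eq_equiv; apply: contrapT => abi; apply: nex.
  by exists i.
have [h hP] := choice sep.
pose maxh a := (\max_(b <- C) (h (a, b)).+1)%N.
exists (\max_(a <- C) maxh a)%N => a b aC bC.
move=> /(congr1 (fun s => nth false s (h (a, b)))).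
have lt_h : (h (a, b) < \max_(a <- C) maxh a)%N.
  apply: leq_trans (leq_bigmax_seq (F := maxh) _ aC isT).
  exact: (leq_bigmax_seq (F := fun b => (h (a, b)).+1) _ bC isT).
rewrite !nth_mkseq// => abh; apply: contrapT => /(hP (a, b)); exact.
Qed.

(** Once n is large enough to separate the members of C, the words of those
    members of C that lie in s select exactly them. *)
Lemma independent_setP (s : set (set nat)) (C : seq (set nat)) :
  exists p, forall a, a \in C -> (independent_set a p <-> s a).
Proof.
have [n nC] := prefix_code_separates C.
exists (n, [seq prefix_code a n | a <- C & `[< s a >]]) => a aC.
rewrite /independent_set /=; split=> [/mapP[b]|sa].
  by rewrite mem_filter => /andP[/asboolP sb bC] /(nC _ _ aC bC) ->.
by apply: map_f; rewrite mem_filter aC andbT; exact/asboolP.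
Qed.

(** * Avoiding few values *)

Lemma card_le_inj (T U : Type) (f : T -> U) (A : set T) (B : set U) :
  {in A &, injective f} -> (forall x, A x -> B (f x)) -> A #<= B.
Proof.
move=> finj fB; rewrite -(card_le_eql (inj_card_eq finj)).
by apply: subset_card_le => _ [x Ax <-]; exact: fB.
Qed.

(** An injection of pairs: the subsets of nat that contain 0 record s, the
    others record t. *)
Definition row_pair (s t : set (set nat)) : set (set nat) :=
  [set X | if `[< X 0%N >] then s (fun n => X n.+1) else t (fun n => X n.+1)].

Lemma row_pair_inj s t s' t' :
  row_pair s t = row_pair s' t' -> s = s' /\ t = t'.
Proof.
move=> st; split; apply/funext => X.
  pose Y n := if n is m.+1 then X m else True.
  have := congr1 (fun r => r Y) st; rewrite /row_pair /=.
  by rewrite asboolT.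
pose Y n := if n is m.+1 then X m else False.
have := congr1 (fun r => r Y) st; rewrite /row_pair /=.
by rewrite asboolF.
Qed.

(** For fixed s, call the values Phi (row_pair s t) the row of s.  Each h c lies
    in at most one row, so Cantor's diagonal set s0 of the codes c that are not
    in the s whose row contains h c has a row disjoint from the range of h. *)
Lemma avoid_range (T : Type) (Phi : set (set nat) -> T) (h : set nat -> T) :
  injective Phi -> exists s, forall t c, Phi (row_pair s t) <> h c.
Proof.
move=> Phi_inj.
pose hit s c := exists t, Phi (row_pair s t) = h c.
exists [set c | ~ exists s, hit s c /\ s c] => t c.
set s0 := (X in row_pair X t) => st.
have s0E : s0 c <-> ~ exists s, hit s c /\ s c by [].
have hit0 s : hit s c -> s = s0.
  by move=> [t' st']; have /Phi_inj/row_pair_inj[] := etrans st' (esym st).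
have hits0 : hit s0 c by exists t.
have [s0c|ns0c] := pselect (s0 c); first by apply: (s0E.1 s0c); exists s0.
by apply/ns0c/s0E => -[s [/hit0 ->]].
Qed.

(** * Coding operators and finitely generated ideals *)

Lemma infinite_injection (G : choiceType) : infinite_set [set: G] ->
  exists iota : nat -> G, injective iota.
Proof.
move=> infG; have [g0 _] : [set: G] !=set0.
  by apply/set0P/eqP => G0; apply: infG; rewrite G0.
pose Gp : pointedType := HB.pack G (isPointed.Build G g0).
have /(@pcard_injP nat Gp)[f finj] : [set: nat] #<= [set: Gp].
  exact/infiniteP.
by exists f => m n; apply: finj; rewrite inE.
Qed.

Section OperatorCodes.
Variables (R : realType) (E : normedModType R[i]).

Lemma bopB (T : bop E) x y : T (x - y) = T x - T y.
Proof.
by have [Tlin _] := bopP T; rewrite addrC -scaleN1r Tlin scaleN1r addrC.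
Qed.

Lemma bop_rbound (T : bop E) :
  exists2 c : R, 0 < c & forall x, rnorm (T x) <= c * rnorm x.
Proof.
have [_ [M TM]] := bopP T.
have /complex_realP[m mE] : `|M| \is Num.real by exact: normr_real.
have m0 : 0 <= m by rewrite -ler0c -mE.
exists (m + 1) => [|x]; first by rewrite ltr_wpDl.
apply: (@le_trans _ _ (m * rnorm x)); last first.
  by rewrite ler_wpM2r ?rnorm_ge0// lerDl.
rewrite -lecR rmorphM /= !rnormE -mE.
apply: le_trans (TM x) _; have Mx0 : 0 <= M * `|x| by apply: le_trans (TM x).
by rewrite -[leLHS]ger0_norm// normrM normr_id.
Qed.

(** The code of T lists the triples (d, d', n) with d, d' in the dense set and
    |T d - d'| < 1 / (n + 1): these determine T d, and then T by continuity. *)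
Lemma bop_codes : separable_space E -> exists e : bop E -> set nat, injective e.
Proof.
move=> [D /countable_injP[f finj] Ddense].
have approx (x : E) (eps : R) : 0 < eps -> exists2 d, D d & rnorm (x - d) < eps.
  move=> eps0; have [||d [xd Dd]] := Ddense (ball x eps%:C).
  - by exists x; apply: ballxx; rewrite ltcR.
  - exact: ball_open.
  - by exists d => //; move: xd; rewrite -ball_normE /= -rnormE ltcR.
pose e (T : bop E) : set nat := [set k | exists (d d' : E) (n : nat),
  [/\ D d, D d', k = choice.pickle (f d, f d', n) &
      rnorm (T d - d') < n.+1%:R^-1]].
exists e => S T eST.
have STD d : D d -> S d = T d.
  move=> Dd; apply: eq_rdist_le => eps eps0.
  have [n ne] := ltr_add_invr (divr_gt0 eps0 (ltr0Sn _ 1)); rewrite add0r in ne.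
  have n0 : 0 < n.+1%:R^-1 :> R by rewrite invr_gt0.
  have [d' Dd' Sd'] := approx (S d) _ n0.
  have : e S (choice.pickle (f d, f d', n)) by exists d, d', n.
  rewrite eST => -[d1 [d1' [n1 [D1 D1']]]].
  move=> /(pcan_inj choice.pickleK)[fd fd' <-].
  have -> : d1 = d by apply: finj => //; rewrite inE.
  have -> : d1' = d' by apply: finj => //; rewrite inE.
  move: Sd' ne; set q := n.+1%:R^-1 => Sd' ne Td'.
  have := ler_rdistD d' (S d) (T d); rewrite [rnorm (d' - T d)]rdistC.
  by clearbody q; lra.
apply: bop_ext => x; apply: eq_rdist_le => eps eps0.
have [a a0 Sa] := bop_rbound S; have [b b0 Tb] := bop_rbound T.
have ab0 : 0 < a + b by rewrite addr_gt0.
have [d Dd xd] := approx x _ (divr_gt0 eps0 ab0).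
rewrite ltr_pdivlMr// in xd.
have := ler_rdistD (S d) (S x) (T x); rewrite {2}(STD _ Dd) -!bopB.
have := Sa (x - d); have := Tb (d - x); rewrite [rnorm (d - x)]rdistC; lra.
Qed.

End OperatorCodes.

(** A subset c of nat holds countably many codes of elements of A, and the left
    ideal that these elements generate serves as h c. *)
Lemma finitely_generated_codes (A : pzRingType) (e : A -> set nat) :
  injective e ->
  exists h : set nat -> set A, forall I, left_ideal I ->
    finitely_generated_left_ideal I -> exists c, h c = I.
Proof.
move=> e_inj.
have dec_ex (c : set nat) : exists x : A, forall y, e y = c -> y = x.
  have [[x ex]|nex] := pselect (exists x, e x = c).
    by exists x => y ey; apply: e_inj; rewrite ey ex.
  by exists 0 => y ey; case: nex; exists y.
have [dec decP] := choice dec_ex.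
pose t (c : set nat) (i : nat) := dec [set n : nat | c (choice.pickle (i, n))].
exists (fun c =>
  \bigcap_(J in [set J | left_ideal J /\ forall i, J (t c i)]) J).
move=> I idI /(finitely_generated_bigcap idI)[u ->].
pose c := [set k | exists i n : nat, k = choice.pickle (i, n) /\ e (u i) n].
exists c; suff -> : t c = u by [].
apply/funext => i; apply/esym/decP; apply/seteqP; split=> n /=.
  by move=> ein; exists i, n.
by move=> [j [m [/(pcan_inj choice.pickleK)[-> ->]]]].
Qed.

(** * Many maximal left ideals *)

Section CylinderIdeals.
Variables (R : realType) (E : completeNormedModType R[i]) (G : choiceType).
Variables (F : G -> set E) (hF : unconditional_schauder_decomposition F).
Variables (Y : set nat -> set G).
Hypothesis Yindep : forall (s : set (set nat)) (C : seq (set nat)),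
  exists g, forall a, a \in C -> (Y a g <-> s a).

(** The finite set C names the constraints on g; the g that satisfy them form a
    cylinder of the independent family. *)
Definition cylinder_ideal (s : set (set nat)) : set (bop E) :=
  [set T | exists C : seq (set nat), forall g,
     (forall a, a \in C -> (Y a g <-> s a)) -> forall v, F g v -> T v = 0].

Lemma cylinder_ideal_left s : left_ideal (cylinder_ideal s).
Proof.
split.
- by exists [::].
- move=> S T [C CS] [C' CT]; exists (C ++ C') => g sg v Fv.
  rewrite bop_addE (CS g) ?(CT g) ?addr0// => a aC; apply: sg.
    by rewrite mem_cat aC orbT.
  by rewrite mem_cat aC.
- move=> S T [C CT]; exists C => g sg v Fv; rewrite bop_mulE (CT g sg v Fv).
  by rewrite -{1}(subrr 0) bopB subrr.
Qed.

Lemma cylinder_ideal_proper s : ~ cylinder_ideal s 1.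
Proof.
move=> [C C1]; have [g sg] := Yindep s C; have [v Fv /eqP] := piece_neq0 hF g.
by apply; exact: C1 Fv.
Qed.

(** The constraint a alone makes 1 - P or P vanish.  As a proper left ideal
    cannot contain both, this tells s from t whenever a is in exactly one of
    them. *)
Lemma cylinder_projections a : exists P : bop E, forall s,
  (s a -> cylinder_ideal s (1 - P)) /\ (~ s a -> cylinder_ideal s P).
Proof.
have [P PY] := projection_ex hF (Y a); exists P => s.
split=> sa; exists [:: a] => g /(_ a (mem_head _ _)) Yg v Fv.
  rewrite bop_addE (_ : (- P) v = - P v)// (PY _ _ Fv) mem_set ?subrr//.
  exact/Yg.
by rewrite (PY _ _ Fv) memNset// => /Yg.
Qed.

Lemma maximal_left_ideals_inj : exists Phi : set (set nat) -> set (bop E),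
  injective Phi /\ forall s, maximal_left_ideal (Phi s).
Proof.
have ex s : exists M, maximal_left_ideal M /\ cylinder_ideal s `<=` M.
  have [M maxM subM] := exists_maximal_left_ideal (cylinder_ideal_left s)
    (@cylinder_ideal_proper s).
  by exists M.
have [Phi PhiP] := choice ex.
exists Phi; split; last by move=> s; case: (PhiP s).
have half s t a : Phi s = Phi t -> s a -> t a.
  move=> st sa; apply: contrapT => nta; have [P PP] := cylinder_projections a.
  have [maxs subs] := PhiP s; have [_ subt] := PhiP t.
  have h1 := subs _ ((PP s).1 sa); have h2 := subt _ ((PP t).2 nta).
  rewrite -st in h2; have [[_ /(_ _ _ h1 h2) + _] _ _] := maxs.
  by rewrite subrK; exact: maximal_left_ideal1.
by move=> s t st; apply/seteqP; split=> a; apply: half.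
Qed.

End CylinderIdeals.

(** * The count *)

Theorem corollary3p3 (R : realType) (E : completeNormedModType R[i])
    (E_neq0 : exists x : E, x <> 0%R) (E_sep : separable_space E)
    (G : choiceType) (F : G -> set E)
    (hF : unconditional_schauder_decomposition F) :
  ([set I : set (bop E) |
      maximal_left_ideal I /\ ~ finitely_generated_left_ideal I]
   #= [set: set (set nat)])%classic%card.
Proof.
have [e e_inj] := bop_codes E_sep; apply/card_eqPle; split.
  apply: (@card_le_inj _ _ (fun I : set (bop E) => e @` I)) => // I J _ _ IJ.
  have half (I' J' : set (bop E)) : e @` I' = e @` J' -> I' `<=` J'.
    move=> IJ' T IT; have : (e @` I') (e T) by exists T.
    by rewrite IJ' => -[S JS /e_inj <-].
  by apply/seteqP; split; apply: half.
have [infG _ _] := hF; have [iota iota_inj] := infinite_injection infG.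
pose Y a : set G :=
  [set g | exists2 p, g = iota (choice.pickle p) & independent_set a p].
have Yindep (s : set (set nat)) (C : seq (set nat)) :
    exists g, forall a, a \in C -> (Y a g <-> s a).
  have [p pP] := independent_setP s C; exists (iota (choice.pickle p)) => a aC.
  split=> [[q /iota_inj/(pcan_inj choice.pickleK) <- /(pP a aC)//]|sa].
  by exists p => //; exact/pP.
have [Phi [Phi_inj Phi_max]] := maximal_left_ideals_inj hF Yindep.
have [h hP] := finitely_generated_codes e_inj.
have [s sP] := avoid_range h Phi_inj.
apply: (@card_le_inj _ _ (fun t => Phi (row_pair s t))).
  by move=> t t' _ _ /Phi_inj/row_pair_inj[].
move=> t _; split=> // fg; have [idPhi _ _] := Phi_max (row_pair s t).
have [c hc] := hP _ idPhi fg.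
exact: (sP t c).
Qed.
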